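(* Let $L$ be a (left) Leibniz algebra over a field $\mathbb{F}$ of characteristic zero which is complete in the following sense: $\mathrm{Z}(L)=0$ and all derivations of $L$ are inner. Let $f\colon L\times L\to L$ be a symmetric bilinear map. Then $f$ is a biderivation of $L$ if and only if there exists a skew-commuting linear map $g\colon L\to L$ such that $$f(x,y)=[g(x),y]\quad\text{for all } x,y\in L.$$
   Context: A (left) Leibniz algebra over a field $\mathbb{F}$ is an $\mathbb{F}$-vector space $L$ with an $\mathbb{F}$-bilinear map $[-,-]\colon L\times L\to L$ satisfying $[x,[y,z]]=[y,[x,z]]+[[x,y],z]$ for all $x,y,z\in L$. The center is $\mathrm{Z}(L)=\{x\in L\mid [x,y]=[y,x]=0 \text{ for all } y\in L\}$. A derivation of $L$ is a linear map $D\colon L\to L$ with $D([x,y])=[D(x),y]+[x,D(y)]$ for all $x,y\in L$. A derivation is inner if it equals a left multiplication $L_x\colon y\mapsto [x,y]$ for some $x\in L$. A biderivation of $L$ is an $\mathbb{F}$-bilinear map $f\colon L\times L\to L$ such that $f(x,-)$ and $f(-,x)$ are derivations of $L$ for all $x\in L$. The map $f$ is symmetric if $f(x,y)=f(y,x)$ for all $x,y\in L$. A linear map $g\colon L\to L$ is skew-commuting if $[g(x),y]=[g(y),x]$ for all $x,y\in L$. *)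

(* Defs.v *)
From HB Require Import structures.
From mathcomp Require Import all_boot all_order all_algebra.

Set Implicit Arguments.
Unset Strict Implicit.
Unset Printing Implicit Defensive.

Import GRing.Theory.
Local Open Scope ring_scope.

HB.mixin Record Lmodule_isLeftLeibniz (F : fieldType) L
    of GRing.Lmodule F L := {
  bracket : {bilinear L -> L -> L};
  left_leibniz : forall x y z : L,
    bracket x (bracket y z) = bracket y (bracket x z) + bracket (bracket x y) z
}.

#[short(type="leftLeibnizType")]
HB.structure Definition LeftLeibniz (F : fieldType) :=
  { L of GRing.Lmodule F L & Lmodule_isLeftLeibniz F L }.

Declare Scope leibniz_scope.
Notation "⁅ x , y ⁆" := (bracket x y)
  (at level 0, x, y at level 99, format "⁅ x ,  y ⁆") : leibniz_scope.
Open Scope leibniz_scope.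

Section LeibnizDefs.
Variables (F : fieldType) (L : leftLeibnizType F).

Definition in_center (x : L) : Prop :=
  forall y : L, ⁅x, y⁆ = 0 /\ ⁅y, x⁆ = 0.

Definition is_derivation (D : L -> L) : Prop :=
  linear D /\ forall x y : L, D ⁅x, y⁆ = ⁅D x, y⁆ + ⁅x, D y⁆.

Definition is_inner (D : L -> L) : Prop :=
  exists x : L, forall y : L, D y = ⁅x, y⁆.

Definition is_complete : Prop :=
  (forall x : L, in_center x -> x = 0) /\
  (forall D : L -> L, is_derivation D -> is_inner D).

Definition is_biderivation (f : {bilinear L -> L -> L}) : Prop :=
  forall x : L, is_derivation (f x) /\ is_derivation (fun y : L => f y x).

Definition is_skew_commuting (g : {linear L -> L}) : Prop :=
  forall x y : L, ⁅g x, y⁆ = ⁅g y, x⁆.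

End LeibnizDefs.

(* Main.v *)
(** For [f] symmetric, [f] is a biderivation iff every [f x -] is a derivation,
    that is, iff every [f x -] is inner.  The left center
    [{u | [u, -] = 0}] need not vanish when [L] has trivial center (it contains
    all squares), so the element representing [f x -] is not unique, and the
    linearity of [x |-> g x] is not automatic: [g] is a linear selection of the
    linear relation [f x - = [u, -]], which Zorn's lemma provides. *)
Require Import Defs.
From HB Require Import structures.
From mathcomp Require Import all_boot all_order all_algebra.
From mathcomp Require Import boolp classical_sets.
Import GRing.Theory.
Local Open Scope ring_scope.

(** A maximal single-valued linear subrelation of [R] is defined everywhere, since one more pair of
    [R] could otherwise be adjoined; it is then the graph of [g]. *)
Lemma linear_selection (F : fieldType) (V W : lmodType F) (R : V -> W -> Prop) :
    (forall a x u y v, R x u -> R y v -> R (a *: x + y) (a *: u + v)) ->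
    (forall x, exists u, R x u) ->
  exists g : {linear V -> W}, forall x, R x (g x).
Proof.
move=> R_lin R_tot.
have R0 : R 0 0.
  have [u Ru] := R_tot 0.
  by move: (R_lin (-1) _ _ _ _ Ru Ru); rewrite !scaleN1r !addNr.
pose closed (G : set (V * W)) := forall a p q, G p -> G q -> G (a *: p + q).
(* Graphs of partial linear selections: by linearity, single-valuedness need only be required at
   [0]. *)
pose P (G : set (V * W)) := [/\ closed G, forall p, G p -> R p.1 p.2
  & forall u, G (0, u) -> u = 0].
have [|G [[G_lin GR G0] G_max]] := @Zorn_bigcup _ P.
- move=> C CP C_tot; split.
  + move=> a p q [A CA Ap] [B CB Bq].
    have [AB|BA] := C_tot _ _ CA CB.
      by exists B => //; have [B_lin _ _] := CP _ CB; apply: B_lin => //; apply: AB.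
    by exists A => //; have [A_lin _ _] := CP _ CA; apply: A_lin => //; apply: BA.
  + by move=> p [A CA Ap]; have [_ AR _] := CP _ CA; apply: AR.
  + by move=> u [A CA Au]; have [_ _ A0] := CP _ CA; apply: A0.
have G00 : G 0.
  (* The empty set satisfies [P], so it must be excluded by maximality. *)
  apply: contrapT => nG0; have G_empty p : ~ G p.
    by move=> Gp; apply: nG0; rewrite -(addNr p) -scaleN1r; apply: G_lin.
  apply: (G_max (fun p => p = 0)).
    by split=> [p /G_empty //|/(_ 0 erefl)].
  split=> [a p q -> ->|p ->|u [->]] //.
  by rewrite scaler0 addr0.
have G_tot x : exists u, G (x, u).
  apply: contrapT => nGx; have [w Rxw] := R_tot x.
  (* Adjoining [(x, w)] to [G] and taking the span contradicts maximality. *)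
  pose G' : set (V * W) := fun p => exists a q, G q /\ p = a *: (x, w) + q.
  apply: (G_max G').
    split=> [p Gp|G'G]; first by exists 0, p; rewrite scale0r add0r.
    by apply: nGx; exists w; apply: G'G; exists 1, 0; rewrite scale1r addr0.
  split.
  - move=> a _ _ [b [p [Gp ->]]] [c [q [Gq ->]]].
    exists (a * b + c), (a *: p + q); split; first exact: G_lin.
    by rewrite scalerDr scalerA scalerDl addrACA.
  - by move=> _ [a [q [/GR Rq ->]]]; apply: R_lin.
  - move=> u [a [[y v] [Gq [xy ->]]]].
    (* If [a] is nonzero, [y = - (a *: x)] puts [x] in the domain of [G], against [nGx]. *)
    have [a0|a_neq0] := eqVneq a 0.
      by move: xy Gq; rewrite a0 !scale0r !add0r => <- /G0.
    case: nGx; exists (- a^-1 *: v).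
    have := G_lin (- a^-1) _ _ Gq G00; rewrite addr0.
    suff <- : - a^-1 *: y = x by [].
    have -> : y = - (a *: x) by apply/eqP; rewrite -addr_eq0 addrC -xy.
    by rewrite scaleNr scalerN opprK scalerA mulVf // scale1r.
have [g Gg] := choice G_tot.
have g_lin : linear g.
  (* The defect of linearity of [g] is related to [0] by [G], so it vanishes. *)
  move=> a x y; apply/eqP; rewrite -subr_eq0; apply/eqP/G0.
  have := G_lin (-1) _ _ (G_lin a _ _ (Gg x) (Gg y)) (Gg (a *: x + y)).
  suff -> : -1 *: (a *: (x, g x) + (y, g y)) + (a *: x + y, g (a *: x + y))
    = (0, g (a *: x + y) - (a *: g x + g y)) by [].
  by rewrite scaleN1r; congr pair; rewrite /= addrC ?subrr.
pose gM := GRing.isLinear.Build F V W *:%R g g_lin.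
pose gL : {linear V -> W} := HB.pack g gM.
by exists gL => x; apply: (GR (x, g x)).
Qed.

Theorem proposition4p5 (F : fieldType) (charF0 : [pchar F] =i pred0)
  (L : leftLeibnizType F) (completeL : is_complete L)
  (f : {bilinear L -> L -> L}) (f_sym : forall x y : L, f x y = f y x) :
  is_biderivation f <->
  exists g : {linear L -> L},
    is_skew_commuting g /\ forall x y : L, f x y = ⁅g x, y⁆.
Proof.
split=> [f_bider|[g [_ fE]] x].
- have [|x|g fE] := @linear_selection F L L (fun x u => forall y, f x y = ⁅u, y⁆).
  + by move=> a x u y v fx fy z; rewrite !linearPl fx fy.
  + by have [_ der_inner] := completeL; apply/der_inner/(f_bider x).1.
  (* Through [fE], skew-commutation of [g] is the symmetry of [f]. *)
  + by exists g; split=> // x y; rewrite -!fE f_sym.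
- have fx_der : is_derivation (f x).
    split=> [|y z]; first exact: linearP.
    (* The Leibniz identity makes left multiplication by [g x] a derivation. *)
    by rewrite !fE left_leibniz addrC.
  split=> //; suff -> : (fun y => f y x) = f x by [].
  by apply/funext => y; apply: f_sym.
Qed.
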